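(* Let $I \subseteq \mathbb{R}$ be an interval, let $f \in MT(I)$, let $a,b \in I$ with $a<b$, and suppose $f \in L_1[a,b]$. Then $$f\left(\frac{a+b}{2}\right) \leq \frac{1}{b-a}\int_a^b f(x)\,dx$$ and $$\frac{2}{b-a}\int_a^b \tau(x) f(x)\,dx \leq \frac{f(a)+f(b)}{2},$$ where $\tau(x) = \frac{\sqrt{(b-x)(x-a)}}{b-a}$ for $x \in [a,b]$.
   Context: A function $f: I \subseteq \mathbb{R} \to \mathbb{R}$ is said to belong to the class $MT(I)$ (to be $MT$-convex on $I$) if it is nonnegative and for all $x,y \in I$ and all $t \in (0,1)$ it satisfies $$f(tx+(1-t)y) \leq \frac{\sqrt{t}}{2\sqrt{1-t}} f(x) + \frac{\sqrt{1-t}}{2\sqrt{t}} f(y).$$ $L_1[a,b]$ denotes the Lebesgue integrable functions on $[a,b]$. *)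

(* Defs.v *)
From HB Require Import structures.
From mathcomp Require Import all_boot all_order all_algebra.
From mathcomp Require Import all_classical all_reals all_analysis.
Set Implicit Arguments.
Unset Strict Implicit.
Unset Printing Implicit Defensive.
Import Order.TTheory GRing.Theory Num.Theory.
Import numFieldNormedType.Exports.
Local Open Scope classical_set_scope.
Local Open Scope ring_scope.

(* A function on [I] is represented by a total [f : R -> R]; only its values
   on [I] are constrained. *)
Definition MT_convex (R : realType) (I : set R) (f : R -> R) : Prop :=
  (forall x, I x -> 0 <= f x) /\
  (forall x y, I x -> I y -> forall t, 0 < t < 1 ->
     f (t * x + (1 - t) * y) <=
       Num.sqrt t / (2 * Num.sqrt (1 - t)) * f x
       + Num.sqrt (1 - t) / (2 * Num.sqrt t) * f y).

Definition tau (R : realType) (a b x : R) : R :=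
  Num.sqrt ((b - x) * (x - a)) / (b - a).

(* [lebesgue_measure] lives on the Borel sigma-algebra; Lebesgue integrability
   only asks for Lebesgue measurability, hence the completed measure, whose
   measurable sets are the Caratheodory-measurable (i.e. Lebesgue) ones. *)
Definition L1 (R : realType) (a b : R) (f : R -> R) : Prop :=
  (@completed_lebesgue_measure R).-integrable `[a, b] (EFin \o f).

Definition Lint (R : realType) (a b : R) (f : R -> R) : R :=
  \int[@completed_lebesgue_measure R]_(x in `[a, b]) f x.

(* Main.v *)
(* At [t = 1/2] the MT inequality says that [2 f((a+b)/2) <= f x + f (a+b-x)].
   Writing [x = t a + (1-t) b], we have [tau x = sqrt (t (1-t))], and
   multiplying the MT inequality for [a], [b], [t] by it clears the weights:
   [tau x * f x <= (t f a + (1-t) f b) / 2].  Adding this to its image under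
   [x |-> a+b-x] leaves the constant bound [(f a + f b) / 2].  Both claims follow
   by integration, because completed Lebesgue measure is reflection invariant:
   invariance on Borel sets comes from uniqueness of Lebesgue measure, and a
   Lebesgue measurable set is a Borel set up to a negligible one. *)
Require Import Defs.
From mathcomp Require Import all_boot all_order all_algebra.
From mathcomp Require Import all_classical all_reals all_analysis measurable_realfun.
From mathcomp Require Import ring lra.
Set Implicit Arguments.
Unset Strict Implicit.
Unset Printing Implicit Defensive.
Import Order.TTheory GRing.Theory Num.Theory.
Import numFieldNormedType.Exports.
Local Open Scope classical_set_scope.
Local Open Scope ring_scope.

(** * Reflection invariance of completed Lebesgue measure *)

Local Notation completedR R := (caratheodory_type (@wlength R idfun)^*%mu).

(** Caratheodory sets form the sigma-algebra generated by Borel sets modified by negligible ones,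
    and those sets are already a sigma-algebra. *)
Lemma completed_measurableP (R : realType) (A : set (completedR R)) :
  measurable A <-> exists X N, [/\ @measurable _ (measurableTypeR R) X,
    (@lebesgue_measure R).-negligible N & A = X `|` N].
Proof.
have -> : measurable A = completed_algebra_gen (@lebesgue_measure R) A.
  by rewrite -g_sigma_completed_algebra_genE completed_caratheodory_measurable.
split=> [[X mX [N N0 <-]]|[X [N [mX N0 ->]]]]; first by exists X, N.
by exists X => //; exists N.
Qed.

Lemma borel_completed_measurable (R : realType) (A : set R) :
  @measurable _ (measurableTypeR R) A ->
  @measurable _ (completedR R) A.
Proof. exact: sub_caratheodory. Qed.

Lemma lebesgue_measure_subl (R : realType) (c : R) (A : set R) :
  @measurable _ (measurableTypeR R) A ->
  lebesgue_measure ((fun x => c - x) @^-1` A) = lebesgue_measure A.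
Proof.
move=> mA; apply/esym.
apply: (@lebesgue_measure_unique _
  (@pushforward _ _ (measurableTypeR R) (measurableTypeR R) _
     lebesgue_measure (fun x => c - x))) => //; first exact: measurable_funB.
move=> _ _ [[x y] _ <-] /=.
(* Reflection turns the generator []x, y]] into an interval closed at the other end, of the same
   length. *)
transitivity (lebesgue_measure (`[c - y, c - x[%classic : set R)).
  by rewrite !lebesgue_measure_itv/= !lte_fin ltrD2l ltrN2 -!EFinB (_ : c - x - (c - y) = y - x) //; ring.
congr (lebesgue_measure _).
by apply/seteqP; split=> z /=; rewrite !in_itv/=; lra.
Qed.

Lemma measurable_preimage_subl (R : realType) (c : R) (A : set R) :
  @measurable _ (measurableTypeR R) A ->
  @measurable _ (measurableTypeR R) ((fun x => c - x) @^-1` A).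
Proof.
have mr : measurable_fun [set: measurableTypeR R]
  ((fun x => c - x) : _ -> measurableTypeR R) by exact: measurable_funB.
by move=> mA; rewrite -[X in measurable X]setTI; exact: mr.
Qed.

Lemma negligible_preimage_subl (R : realType) (c : R) (N : set R) :
  (@lebesgue_measure R).-negligible N ->
  (@lebesgue_measure R).-negligible ((fun x => c - x) @^-1` N).
Proof.
move=> [B [mB B0 NB]]; exists ((fun x => c - x) @^-1` B); split.
- exact: measurable_preimage_subl.
- by rewrite lebesgue_measure_subl.
- by move=> x /NB.
Qed.

Lemma negligible_completed (R : realType) (N : set R) :
  (@lebesgue_measure R).-negligible N ->
  @measurable _ (completedR R) N /\ completed_lebesgue_measure N = 0%E.
Proof.
move=> N0; have mN : @measurable _ (completedR R) N.
  apply/completed_measurableP; exists set0, N; split => //.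
  by rewrite set0U.
split=> //; apply/(@negligibleP _ _ _ (@completed_lebesgue_measure R) _ mN).
move: N0 => [B [mB B0 NB]]; exists B; split => //.
exact: borel_completed_measurable.
Qed.

Lemma completed_lebesgue_measure_subl (R : realType) (c : R) (A : set R) :
  @measurable _ (completedR R) A ->
  @measurable _ (completedR R) ((fun x => c - x) @^-1` A) /\
  completed_lebesgue_measure ((fun x => c - x) @^-1` A) =
  completed_lebesgue_measure A.
Proof.
move=> /completed_measurableP[X [N [mX N0 ->]]]; rewrite preimage_setU.
have mX' := measurable_preimage_subl c mX.
have N0' := negligible_preimage_subl c N0.
have [mN muN] := negligible_completed N0.
have [mN' muN'] := negligible_completed N0'.
split; first by apply: measurableU => //; exact: borel_completed_measurable.
(* The negligible parts drop out on both sides, which leaves the Borel case. *)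
rewrite !measureU0 //; try exact: borel_completed_measurable.
exact: lebesgue_measure_subl.
Qed.

Lemma measurable_subl (R : realType) (c : R) :
  measurable_fun [set: completedR R] ((fun x => c - x) : _ -> completedR R).
Proof.
by move=> _ A mA; rewrite setTI; have [] := completed_lebesgue_measure_subl c mA.
Qed.

(** * Integrals over [[a, b]] under reflection *)

Lemma preimage_subl_itv (R : realType) (a b : R) :
  (fun x => a + b - x) @^-1` `[a, b] = `[a, b]%classic.
Proof. by apply/seteqP; split=> x /=; rewrite !in_itv/=; lra. Qed.

Lemma completed_measurable_itv (R : realType) (a b : R) :
  @measurable _ (completedR R) `[a, b].
Proof. by apply: borel_completed_measurable; exact: measurable_itv. Qed.

Lemma measurable_fun_subl (R : realType) (a b : R) (g : R -> R) :
  measurable_fun (`[a, b] : set (completedR R)) g ->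
  measurable_fun (`[a, b] : set (completedR R)) (fun x => g (a + b - x)).
Proof.
move=> mg; apply: (@measurable_comp _ _ _ _ (completedR R) _ `[a, b] g) mg _.
- exact: completed_measurable_itv.
- by move=> _ [x + <-]; rewrite -{1}preimage_subl_itv.
- exact: measurable_funTS (measurable_subl _).
Qed.

(** Change of variables along the pushforward, which is the measure itself. Assuming nonnegativity
    rather than integrability lets this apply to [tau a b x * f x] before its integral is known to
    be finite. *)
Lemma integral_subl (R : realType) (a b : R) (g : R -> R) :
  measurable_fun (`[a, b] : set (completedR R)) g ->
  (forall x, a <= x <= b -> 0 <= g x) ->
  (\int[@completed_lebesgue_measure R]_(x in `[a, b]) (g x)%:E =
  \int[@completed_lebesgue_measure R]_(x in `[a, b]) (g (a + b - x))%:E)%E.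
Proof.
move=> mg g0.
have := @ge0_integral_pushforward _ _ (completedR R) (completedR R) R
  _ (measurable_subl (a + b)) completed_lebesgue_measure `[a, b] (EFin \o g).
rewrite preimage_subl_itv => <-.
- apply: eq_measure_integral => [|? A mA _]; first exact: measurable_subl.
  by have [_ muA] := completed_lebesgue_measure_subl (a + b) mA; exact/esym.
- exact: completed_measurable_itv.
- exact/measurable_EFinP.
- by move=> x; rewrite inE/= in_itv/= lee_fin => /g0.
Qed.

Lemma integral_symmetrize (R : realType) (a b : R) (g : R -> R) :
  measurable_fun (`[a, b] : set (completedR R)) g ->
  (forall x, a <= x <= b -> 0 <= g x) ->
  (\int[@completed_lebesgue_measure R]_(x in `[a, b]) (g x)%:E *+ 2 =
  \int[@completed_lebesgue_measure R]_(x in `[a, b])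
     (g x + g (a + b - x))%:E)%E.
Proof.
move=> mg g0; rewrite mule2n {2}integral_subl// -ge0_integralD//.
- exact: completed_measurable_itv.
- exact/measurable_EFinP.
- by move=> x; rewrite /= in_itv/= lee_fin => abx; apply: g0; lra.
- exact/measurable_EFinP/measurable_fun_subl.
Qed.

Lemma completed_integral_cst (R : realType) (a b k : R) : a < b ->
  (\int[@completed_lebesgue_measure R]_(x in `[a, b]) k%:E = (k * (b - a))%:E)%E.
Proof.
move=> ab; rewrite (integral_cst _ (@completed_measurable_itv R a b)).
transitivity (k%:E * lebesgue_measure (`[a, b] : set R))%E => //.
by rewrite lebesgue_measure_itv/= lte_fin ab -EFinB -EFinM.
Qed.

(** * The weight [tau] and pointwise bounds from MT-convexity *)

Lemma measurable_tau (R : realType) (a b : R) :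
  measurable_fun (`[a, b] : set (completedR R)) (tau a b).
Proof.
have mt : measurable_fun [set: measurableTypeR R] (tau a b).
  apply: measurable_funM => //; apply: measurableT_comp.
    by apply: continuous_measurable_fun => x; exact: sqrt_continuous.
  by apply: measurable_funM; exact: measurable_funB.
apply: measurable_funTS => _ A mA; apply: borel_completed_measurable.
exact: mt.
Qed.

Lemma tau_subl (R : realType) (a b x : R) : tau a b (a + b - x) = tau a b x.
Proof. by rewrite /tau; congr (Num.sqrt _ / _); ring. Qed.

Lemma MT_midpoint (R : realType) (I : set R) (f : R -> R) (x y : R) :
  MT_convex I f -> I x -> I y -> f ((x + y) / 2) *+ 2 <= f x + f y.
Proof.
move=> [_ hf] Ix Iy; have half01 : 0 < (2^-1 : R) < 1 by lra.
have := hf _ _ Ix Iy _ half01.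
have -> : 1 - 2^-1 = 2^-1 :> R by field.
have s0 : Num.sqrt 2^-1 != 0 :> R by rewrite gt_eqF// sqrtr_gt0; lra.
have -> : Num.sqrt 2^-1 / (2 * Num.sqrt 2^-1) = 2^-1 :> R by field.
have -> : 2^-1 * x + 2^-1 * y = (x + y) / 2 by field.
move=> h; rewrite mulr2n; lra.
Qed.

Lemma MT_tau_bound (R : realType) (I : set R) (f : R -> R) (a b x : R) :
  MT_convex I f -> I a -> I b -> a < b -> a <= x <= b ->
  tau a b x * f x <= ((b - x) * f a + (x - a) * f b) / (2 * (b - a)).
Proof.
move=> [f0 hf] Ia Ib ab /andP[]; have ba0 : 0 < b - a by lra.
have fa := f0 _ Ia; have fb := f0 _ Ib.
(* The endpoints correspond to [t = 1] and [t = 0], outside the range of the MT inequality; there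
   [tau] vanishes and the right side is nonnegative. *)
rewrite le_eqVlt => /predU1P[<- _|ax].
  rewrite /tau subrr mulr0 sqrtr0 !mul0r addr0.
  by rewrite divr_ge0 ?mulr_ge0//; lra.
rewrite le_eqVlt => /predU1P[->|xb].
  rewrite /tau subrr !mul0r sqrtr0 !mul0r add0r.
  by rewrite divr_ge0 ?mulr_ge0//; lra.
have [t tE] : {t | t = (b - x) / (b - a)} by exists ((b - x) / (b - a)).
have t0 : 0 < t by rewrite tE divr_gt0//; lra.
have t1 : t < 1 by rewrite tE ltr_pdivrMr//; lra.
have t01 : 0 < t < 1 by rewrite t0.
have := hf _ _ Ia Ib _ t01.
have -> : t * a + (1 - t) * b = x by rewrite tE; field; lra.
have tauE : tau a b x = Num.sqrt t * Num.sqrt (1 - t).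
  rewrite -sqrtrM ?(ltW t0)// /tau.
  have -> : (b - x) * (x - a) = (t * (1 - t)) * (b - a) ^+ 2.
    by rewrite tE; field; lra.
  rewrite (@sqrtrM _ (t * (1 - t))); last by rewrite mulr_ge0//; lra.
  by rewrite sqrtr_sqr gtr0_norm// mulfK// gt_eqF.
have st0 : 0 < Num.sqrt t by rewrite sqrtr_gt0.
have su0 : 0 < Num.sqrt (1 - t) by rewrite sqrtr_gt0; lra.
move=> /(ler_wpM2l (ltW (mulr_gt0 st0 su0))); rewrite -tauE => /le_trans; apply.
have stE : Num.sqrt t ^+ 2 = t by rewrite sqr_sqrtr// ltW.
have suE : Num.sqrt (1 - t) ^+ 2 = 1 - t by rewrite sqr_sqrtr//; lra.
(* What remains is an equality: multiplied by [Num.sqrt t * Num.sqrt (1 - t)], the MT weights become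
   [t / 2] and [(1 - t) / 2]. *)
rewrite tauE le_eqVlt; apply/predU1P; left.
transitivity (Num.sqrt t ^+ 2 / 2 * f a + Num.sqrt (1 - t) ^+ 2 / 2 * f b).
  by field; rewrite !gt_eqF.
by rewrite stE suE tE; field; lra.
Qed.

(** * Integration of the pointwise bounds *)

Theorem theorem2 (R : realType) (I : set R) (f : R -> R) (a b : R)
    (hI : is_interval I) (hf : MT_convex I f)
    (ha : I a) (hb : I b) (hab : a < b) (hint : L1 a b f) :
  f ((a + b) / 2) <= (b - a)^-1 * Lint a b f /\
  2 / (b - a) * Lint a b (fun x => tau a b x * f x) <= (f a + f b) / 2.
Proof.
have ba0 : 0 < b - a by lra.
have Iab x : a <= x <= b -> I x by move=> abx; exact: hI ha hb x abx.
have f0 x : a <= x <= b -> 0 <= f x by move=> /Iab; exact: hf.1.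
have mf : measurable_fun (`[a, b] : set (completedR R)) f.
  exact/measurable_EFinP/(measurable_int _ hint).
have mab := @completed_measurable_itv R a b.
split.
  have Jfin : (\int[@completed_lebesgue_measure R]_(x in `[a, b]) (f x)%:E
      \is a fin_num)%E by exact: integrable_fin_num.
  rewrite [leRHS]mulrC ler_pdivlMr//.
  have : ((f ((a + b) / 2) *+ 2 * (b - a))%:E <=
      (Lint a b f *+ 2)%:E)%E.
    rewrite EFin_natmul /Lint /Rintegral fineK// integral_symmetrize//.
    rewrite -completed_integral_cst//; apply: ge0_le_integral => //.
    - move=> x _; rewrite lee_fin mulrn_wge0// f0//; lra.
    - apply/measurable_EFinP/measurable_funD => //.
      exact: measurable_fun_subl.
    - move=> x; rewrite /= in_itv/= lee_fin => abx.
      (* This exhibits [(a + b) / 2] as the midpoint of [x] and its reflection, but also rewrites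
         inside the reflected point, which the next line restores. *)
      have -> : a + b = x + (a + b - x) by ring.
      rewrite (_ : x + (a + b - x) - x = a + b - x); last by ring.
      by apply: (MT_midpoint hf); apply: Iab; lra.
  rewrite lee_fin !mulr2n; lra.
have tf0 x : a <= x <= b -> 0 <= tau a b x * f x.
  by move=> abx; rewrite mulr_ge0 ?f0// divr_ge0 ?sqrtr_ge0 ?ltW.
have mtf : measurable_fun (`[a, b] : set (completedR R))
    (fun x => tau a b x * f x).
  by apply: measurable_funM => //; exact: measurable_tau.
set J := (\int[@completed_lebesgue_measure R]_(x in `[a, b])
  (tau a b x * f x)%:E)%E.
have J0 : (0 <= J)%E.
  by apply: integral_ge0 => x; rewrite /= in_itv/= lee_fin => /tf0.
have J2 : (J *+ 2 <= ((f a + f b) / 2 * (b - a))%:E)%E.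
  rewrite integral_symmetrize// -completed_integral_cst//.
  apply: ge0_le_integral => //.
  - move=> x; rewrite /= in_itv/= lee_fin => abx.
    by rewrite addr_ge0 ?tf0//; lra.
  - apply/measurable_EFinP/measurable_funD => //.
    exact: (measurable_fun_subl mtf).
  - move=> x; rewrite /= in_itv/= lee_fin => abx.
    (* Reflection swaps [b - x] and [x - a], so in the sum of the two bounds [f a] and [f b] both
       get the coefficient [b - a]. *)
    have abx' : a <= a + b - x <= b by lra.
    have := lerD (MT_tau_bound hf ha hb hab abx)
                 (MT_tau_bound hf ha hb hab abx').
    move=> /le_trans; apply; rewrite le_eqVlt; apply/predU1P; left.
    by field; lra.
(* [Lint] is [fine] of [J], so the bound passes to the reals only once [J] is finite; this follows
   from the bound itself, since [0 <= J <= J *+ 2]. *)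
have Jfin : J \is a fin_num.
  rewrite ge0_fin_numE//; apply: (@le_lt_trans _ _ (J *+ 2)%E).
    by rewrite mule2n leeDl.
  by rewrite (le_lt_trans J2)// ltry.
move: J2; rewrite /Lint /Rintegral -/J -[J in (J *+ 2)%E]fineK//.
rewrite -EFin_natmul lee_fin => J2.
by rewrite mulrAC ler_pdivrMr// mulr_natl.
Qed.
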